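(* For every real number $c>0$ there exists a constant $C>0$, depending only on $c$, such that the following holds. Let $p$ be a prime, let $K>0$ be a real number, let $A \subseteq \mathbb{F}_p$ satisfy $|A| \leq c\, p^{1/2}$ and $|2A| \leq K|A|$, and let $S = \{a^2 : a \in A\}$. Then \[ |3S| \geq C\, |A|^{1+1/9} K^{-6}. \]
   Context: For a subset $X$ of $\mathbb{F}_p$ and an integer $s \geq 2$, the $s$-fold sumset is $sX = \{x_1+\dots+x_s : x_1,\dots,x_s \in X\}$. The paper writes the hypothesis as $|A| \ll p^{1/2}$ and the conclusion with $\gg$, where $Y \ll X$ (equivalently $X \gg Y$) is Vinogradov notation: $X \geq C|Y|$ for some positive constant $C$. The claim spells this out. *)

(* Defs.v *)
From HB Require Import structures.
From mathcomp Require Import all_boot all_order all_algebra.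
From mathcomp Require Import reals exp.

Set Implicit Arguments.
Unset Strict Implicit.
Unset Printing Implicit Defensive.

Import Order.TTheory GRing.Theory Num.Theory.
Local Open Scope ring_scope.

Definition nfold_sumset (T : finZmodType) (s : nat) (X : {set T}) : {set T} :=
  [set \sum_(i < s) x i | x : {ffun 'I_s -> T} in ffun_on (mem X)].

Definition square_set (T : finNzRingType) (X : {set T}) : {set T} :=
  [set a ^+ 2 | a in X].

(* Main.v *)
Require Import Defs.
From HB Require Import structures.
From mathcomp Require Import all_boot all_order all_algebra.
From mathcomp Require Import reals exp.
From mathcomp Require Import zify ring lra.

Set Implicit Arguments.
Unset Strict Implicit.
Unset Printing Implicit Defensive.

Import Order.TTheory GRing.Theory Num.Theory.
Local Open Scope ring_scope.

(** The proof is an elementary pivot argument of sum-product type.  Write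
    n = |A|, let S be the set of squares of A, M = |3S| / n and D = A - A.
    Since |2S| <= |3S|, it is enough to show n <= C0 M^6 K^52 with C0
    depending on c only: combined with the trivial n <= 2 |3S| this gives
    n^10 <= 8 C0 |3S|^9 K^54, and the ninth root is the theorem.

    Because |2S| <= M n, Cauchy-Schwarz produces at least n^3 / M quadruples
    of elements of A with a^2 - b^2 = a'^2 - b'^2, that is,
    (a - b)(a + b) = (a' - b')(a' + b').  Additive information on squares has
    become multiplicative information on the differences d = a - b and
    d' = a' - b', both of which range over the small set D.  Pigeonholing fixes
    one value d0 of d' ([rich_difference]); for many d in D there is then a
    large subset B of A with 2 d B contained in a translate of 2 d0 A
    ([popular]).  Let X be the set of these d; it has at least n / (4 K^2 M)
    elements.  By the covering lemma of Ruzsa, d (X + X) is covered, for each d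
    in X, by 4 K^10 M translates of the single set 2 d0 (A - A)
    ([dilate_cover]).  Hence every combination
    x3 (X + X) - x4 (X + X) + x1 (X + X) - x2 (X + X) with coefficients in X
    lies in few translates of the dilate by 2 d0 of the difference of sumsets
    4A - 4A, whose size is at most K^8 n by the inequality of Plunnecke ([card_nfold_difference]).  So
    |X + X + r X| is at most about K^48 M^4 n for every quotient
    r = (x1 - x2) / (x3 - x4) ([card_ratio_sumset]).

    On the other hand some such quotient r makes X + X + r X almost as large as
    |X|^2 ([exists_large_ratio_sum]): if not, the set of quotients would be
    stable under adding 1, hence would be all of F_p, whereas an average r
    already makes X + r X that large.  This is where |A| <= c sqrt p enters.
    Comparing the two bounds gives n <= C0 M^6 K^52
    ([square_sumset_bound]). *)

(** * Sumsets *)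

Definition sumset (T : finZmodType) (X Y : {set T}) : {set T} :=
  [set x + y | x in X, y in Y].

Definition oppset (T : finZmodType) (X : {set T}) : {set T} :=
  [set - x | x in X].

Definition dilate (F : finNzRingType) (r : F) (X : {set F}) : {set F} :=
  [set r * x | x in X].

Notation "X <+> Y" := (sumset X Y) (at level 50, left associativity).

Lemma sumsetP (T : finZmodType) (X Y : {set T}) z :
  reflect (exists x y, [/\ x \in X, y \in Y & z = x + y]) (z \in sumset X Y).
Proof.
apply: (iffP imset2P) => [[x y xX yY ->]|[x [y [xX yY ->]]]]; first by exists x, y.
by exists x y.
Qed.

Lemma mem_sumset (T : finZmodType) (X Y : {set T}) x y :
  x \in X -> y \in Y -> x + y \in sumset X Y.
Proof. by move=> xX yY; apply: imset2_f. Qed.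

Lemma sumsetC (T : finZmodType) (X Y : {set T}) : X <+> Y = Y <+> X.
Proof.
by apply/setP => z; apply/sumsetP/sumsetP => -[x [y [? ? ->]]]; exists y, x; rewrite addrC.
Qed.

Lemma sumsetA (T : finZmodType) (X Y Z : {set T}) :
  X <+> (Y <+> Z) = X <+> Y <+> Z.
Proof.
apply/setP => w; apply/sumsetP/sumsetP.
  move=> [x [_ [xX /sumsetP[y [z [yY zZ ->]]] ->]]].
  by exists (x + y), z; rewrite mem_sumset // addrA.
move=> [_ [z [/sumsetP[x [y [xX yY ->]]] zZ ->]]].
by exists x, (y + z); rewrite mem_sumset // addrA.
Qed.

Lemma zero_sumset (T : finZmodType) (X : {set T}) : [set 0] <+> X = X.
Proof.
apply/setP => x; apply/sumsetP/idP => [[_ [y [/set1P-> yX ->]]]|xX].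
  by rewrite add0r.
by exists 0, x; rewrite inE eqxx add0r.
Qed.

Lemma set0_sumset (T : finZmodType) (X : {set T}) : set0 <+> X = set0.
Proof. by apply/setP => x; rewrite inE; apply/sumsetP => -[y [z []]]; rewrite inE. Qed.

Lemma sumsetUl (T : finZmodType) (X Y Z : {set T}) :
  (X :|: Y) <+> Z = (X <+> Z) :|: (Y <+> Z).
Proof. exact: imset2Ul. Qed.

Lemma sumsetS (T : finZmodType) (X X' Y Y' : {set T}) :
  X \subset X' -> Y \subset Y' -> X <+> Y \subset X' <+> Y'.
Proof. exact: imset2S. Qed.

Lemma mem_oppset (T : finZmodType) (X : {set T}) x : x \in X -> - x \in oppset X.
Proof. exact: imset_f. Qed.

Lemma card_oppset (T : finZmodType) (X : {set T}) : #|oppset X| = #|X|.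
Proof. exact/card_imset/oppr_inj. Qed.

Lemma leq_card_sumset (T : finZmodType) (X Y : {set T}) :
  (#|X <+> Y| <= #|X| * #|Y|)%N.
Proof. by rewrite /sumset curry_imset2X -cardsX leq_imset_card. Qed.

Lemma card_translate (T : finZmodType) (x : T) (Y : {set T}) :
  #|[set x] <+> Y| = #|Y|.
Proof.
rewrite /sumset imset2_set1l card_imset //; exact: addrI.
Qed.

Lemma leq_sumset (T : finZmodType) x (X Y : {set T}) : x \in X ->
  (#|Y| <= #|X <+> Y|)%N.
Proof.
by move=> xX; rewrite -(card_translate x) subset_leq_card // sumsetS // sub1set.
Qed.

Lemma nfold_sumset0 (T : finZmodType) (X : {set T}) :
  nfold_sumset 0 X = [set 0].
Proof.
apply/setP => y; rewrite inE; apply/imsetP/eqP => [[x _ ->]|->].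
  by rewrite big_ord0.
exists [ffun=> 0]; last by rewrite big_ord0.
by apply/ffun_onP => -[].
Qed.

Lemma nfold_sumsetS (T : finZmodType) (k : nat) (X : {set T}) :
  nfold_sumset k.+1 X = X <+> nfold_sumset k X.
Proof.
apply/setP => y; apply/imsetP/sumsetP.
  move=> [x /ffun_onP xX ->]; rewrite big_ord_recl.
  exists (x ord0), (\sum_(i < k) x (lift ord0 i)); split=> //.
  apply/imsetP; exists [ffun i => x (lift ord0 i)].
    by apply/ffun_onP => i; rewrite ffunE; apply: xX.
  by apply: eq_bigr => i _; rewrite ffunE.
move=> [x0 [_ [x0X /imsetP[x /ffun_onP xX ->] ->]]].
exists [ffun i => if unlift ord0 i is Some j then x j else x0].
  by apply/ffun_onP => i; rewrite ffunE; case: unliftP => [j|] _ //; apply: xX.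
rewrite big_ord_recl ffunE unlift_none; congr (_ + _).
by apply: eq_bigr => i _; rewrite ffunE liftK.
Qed.

Lemma nfold_sumset1 (T : finZmodType) (X : {set T}) : nfold_sumset 1 X = X.
Proof. by rewrite nfold_sumsetS nfold_sumset0 sumsetC zero_sumset. Qed.

Lemma mem_nfold_sumset0 (T : finZmodType) (X : {set T}) : 0 \in nfold_sumset 0 X.
Proof. by rewrite nfold_sumset0 set11. Qed.

Lemma mem_nfold_sumsetS (T : finZmodType) (X : {set T}) k x y :
  x \in X -> y \in nfold_sumset k X -> x + y \in nfold_sumset k.+1 X.
Proof. by rewrite nfold_sumsetS; apply: mem_sumset. Qed.

(** * Plunnecke, Ruzsa and covering inequalities *)

(** Petridis's lemma.  Adding one element x to C adds to C + Z + B a translate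
    of Z + B, except for the translate of Z' + B, where Z' consists of the z for
    which x + z was already in C + Z; minimality of the ratio |Z + B| / |Z|,
    applied to Z', pays exactly for this overlap. *)
Lemma petridis (T : finZmodType) (B Z C : {set T}) :
  (forall Z' : {set T}, Z' \subset Z ->
     (#|Z <+> B| * #|Z'| <= #|Z' <+> B| * #|Z|)%N) ->
  (#|C <+> (Z <+> B)| * #|Z| <= #|Z <+> B| * #|C <+> Z|)%N.
Proof.
move=> Zmin; have [m] := ubnP #|C|; elim: m C => // m IHm C ltCm.
have [->|[x xC]] := set_0Vmem C; first by rewrite !set0_sumset !cards0.
pose C' := C :\ x; pose Z' := [set z in Z | x + z \in C' <+> Z].
have defC : C = [set x] :|: C' by rewrite /C' setD1K.
have sZ'Z : Z' \subset Z by apply/subsetP => z; rewrite inE => /andP[].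
have {}IHm : (#|C' <+> (Z <+> B)| * #|Z| <= #|Z <+> B| * #|C' <+> Z|)%N.
  by apply: IHm; move: ltCm; rewrite (cardsD1 x C) xC.
have upper : (#|C <+> (Z <+> B)| + #|Z' <+> B| <= #|C' <+> (Z <+> B)| + #|Z <+> B|)%N.
  have sub1 : [set x] <+> (Z' <+> B) \subset
      (C' <+> (Z <+> B)) :&: ([set x] <+> (Z <+> B)).
    rewrite subsetI; apply/andP; split; last by rewrite !sumsetS.
    rewrite sumsetA.
    apply/subsetP => _ /sumsetP[_ [b [/sumsetP[_ [z [/set1P-> zZ' ->]]] bB ->]]].
    rewrite sumsetA mem_sumset //.
    by move: zZ'; rewrite inE => /andP[].
  rewrite {1}defC sumsetUl.
  rewrite -(card_translate x (Z <+> B)) -(card_translate x (Z' <+> B)).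
  by rewrite -[leqRHS]cardsUI setUC leq_add2l subset_leq_card.
have lower : (#|C' <+> Z| + #|Z| <= #|C <+> Z| + #|Z'|)%N.
  have sub1 : (C' <+> Z) :&: ([set x] <+> Z) \subset [set x] <+> Z'.
    apply/subsetP => w /setIP[wC' /sumsetP[_ [z [/set1P-> zZ ew]]]].
    by rewrite ew mem_sumset ?inE ?eqxx // zZ -ew.
  rewrite [in leqRHS]defC sumsetUl.
  rewrite -(card_translate x Z) -(card_translate x Z').
  by rewrite -[leqLHS]cardsUI setUC leq_add2l subset_leq_card.
have := Zmin _ sZ'Z.
nia.
Qed.

(** One subset Z of A works for all k at once: a nonempty subset that minimises
    |Z + A| / |Z|, so that each further summand A costs a factor K. *)
Lemma plunnecke (R : realFieldType) (T : finZmodType) (K : R) (A : {set T}) :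
  A != set0 -> #|A <+> A|%:R <= K * #|A|%:R ->
  exists Z : {set T}, [/\ Z \subset A, Z != set0 &
    forall k, #|nfold_sumset k A <+> Z|%:R <= K ^+ k * #|Z|%:R].
Proof.
move=> A0 AAK; pose P (Z : {set T}) := (Z \subset A) && (Z != set0).
pose ratio (Z : {set T}) : R := #|Z <+> A|%:R / #|Z|%:R.
have PA : P A by rewrite /P subxx.
have [Z /andP[sZA Z0] Zmin] := @Order.TotalTheory.arg_minP _ R _ A P ratio PA.
have gt0 (Y : {set T}) : Y != set0 -> 0 < #|Y|%:R :> R by rewrite ltr0n card_gt0.
have ratioK : #|Z <+> A|%:R <= K * #|Z|%:R.
  rewrite -ler_pdivrMr ?gt0 //; apply: le_trans (Zmin A PA) _.
  by rewrite ler_pdivrMr ?gt0.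
exists Z; split=> // k; elim: k => [|k IHk]; first by rewrite nfold_sumset0 zero_sumset expr0 mul1r.
have step : (#|nfold_sumset k A <+> (Z <+> A)| * #|Z| <= #|Z <+> A| * #|nfold_sumset k A <+> Z|)%N.
  apply: petridis => Z' sZ'Z; have [->|Z'0] := eqVneq Z' set0.
    by rewrite cards0 muln0.
  have := Zmin Z'; rewrite /P Z'0 (subset_trans sZ'Z sZA) => /(_ isT).
  rewrite /ratio ler_pdivrMr ?gt0 // mulrAC ler_pdivlMr ?gt0 //.
  by rewrite -!natrM ler_nat.
have -> : nfold_sumset k.+1 A <+> Z = nfold_sumset k A <+> (Z <+> A).
  by rewrite nfold_sumsetS (sumsetC A) -sumsetA (sumsetC A).
rewrite -(ler_pM2r (gt0 Z Z0)) -natrM.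
apply: (@le_trans _ _ (#|Z <+> A| * #|nfold_sumset k A <+> Z|)%:R); first by rewrite ler_nat.
rewrite natrM exprS [leRHS](_ : _ = (K * #|Z|%:R) * (K ^+ k * #|Z|%:R)); last by ring.
exact: ler_pM.
Qed.

(** Writing each d in X - Y as x - y in one fixed way, the map
    (d, z) |-> (x + z, y + z) is injective, as d is the difference of the two
    coordinates. *)
Lemma ruzsa_triangle (T : finZmodType) (X Y Z : {set T}) :
  (#|X <+> oppset Y| * #|Z| <= #|X <+> Z| * #|Y <+> Z|)%N.
Proof.
have [f fP] : exists f : T -> T * T, forall d, d \in X <+> oppset Y ->
    [/\ (f d).1 \in X, (f d).2 \in Y & d = (f d).1 - (f d).2].
  apply: (@fin_all_exists _ _ (fun d (u : T * T) => d \in X <+> oppset Y ->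
    [/\ u.1 \in X, u.2 \in Y & d = u.1 - u.2])) => d.
  case: (boolP (d \in X <+> oppset Y)) => [/sumsetP[x [_ [xX /imsetP[y yY ->] ->]]]|_].
    by exists (x, y).
  by exists (0, 0).
rewrite -!cardsX.
pose g (u : T * T) := ((f u.1).1 + u.2, (f u.1).2 + u.2).
rewrite -(@card_in_imset _ _ g); last first.
  move=> [d z] [d' z'] /setXP[/= dD zZ] /setXP[/= dD' zZ'] /= [e1 e2].
  have [_ _ ed] := fP _ dD; have [_ _ ed'] := fP _ dD'.
  have dd' : d = d'.
    have addBK (u v w : T) : u + w - (v + w) = u - v.
      by rewrite opprD addrACA subrr addr0.
    by rewrite ed ed' -(addBK _ _ z) e1 e2 addBK.
  by move: e1; rewrite dd' => /addrI ->.
apply/subset_leq_card/subsetP => _ /imsetP[[d z] /setXP[/= dD zZ] ->].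
by have [? ? _] := fP _ dD; rewrite inE /= !mem_sumset.
Qed.

Lemma card_nfold_difference (R : realFieldType) (T : finZmodType) (K : R)
    (A : {set T}) i j :
  A != set0 -> #|A <+> A|%:R <= K * #|A|%:R ->
  #|nfold_sumset i A <+> oppset (nfold_sumset j A)|%:R <= K ^+ (i + j) * #|A|%:R.
Proof.
move=> A0 /(plunnecke A0)[Z [sZA Z0 ZK]].
have Zgt0 : 0 < #|Z|%:R :> R by rewrite ltr0n card_gt0.
have le1 : #|nfold_sumset i A <+> oppset (nfold_sumset j A)|%:R <= K ^+ (i + j) * #|Z|%:R.
  rewrite -(ler_pM2r Zgt0) -natrM.
  apply: (@le_trans _ _ (#|nfold_sumset i A <+> Z| * #|nfold_sumset j A <+> Z|)%:R).
    by rewrite ler_nat ruzsa_triangle.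
  rewrite natrM exprD.
  rewrite [leRHS](_ : _ = K ^+ i * #|Z|%:R * (K ^+ j * #|Z|%:R)); last by ring.
  exact: ler_pM.
apply: le_trans le1 _; rewrite ler_wpM2l ?ler_nat ?subset_leq_card //.
have := le_trans (ler0n _ _) (ZK (i + j)); by rewrite pmulr_lge0.
Qed.

(** Take for the covering centres a maximal subset of P whose translates of Q
    are disjoint: any further translate of Q by an element of P meets one of
    them. *)
Lemma ruzsa_covering (T : finZmodType) (P Q : {set T}) : Q != set0 ->
  exists2 X : {set T}, (#|X| * #|Q| <= #|P <+> Q|)%N &
    P \subset X <+> (Q <+> oppset Q).
Proof.
move=> /set0Pn[q0 q0Q].
(* Counting expresses that the translates x + Q with x in X are disjoint. *)
pose ok (X : {set T}) := (X \subset P) && (#|X| * #|Q| <= #|X <+> Q|)%N.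
have ok0 : ok set0 by rewrite /ok sub0set cards0.
have [X /maxsetP[/andP[sXP leX] Xmax] _] := maxset_exists ok0.
exists X; first exact: leq_trans leX (subset_leq_card (sumsetS sXP (subxx _))).
apply/subsetP => x xP; case: (boolP (x \in X)) => [xX|xX].
  by rewrite -[x]addr0 -(subrr q0) !mem_sumset ?mem_oppset.
have [dis|[y yX]] := set_0Vmem ((X <+> Q) :&: ([set x] <+> Q)); last first.
  case/setIP: yX => /sumsetP[t [q [tX qQ ->]]] /sumsetP[_ [q' [/set1P-> q'Q e]]].
  by rewrite -[x](addrK q') -e -addrA !mem_sumset ?mem_oppset.
have okx : ok (x |: X).
  rewrite /ok subUset sub1set xP sXP /= cardsU1 xX sumsetUl.
  by rewrite cardsU setIC dis cards0 subn0 card_translate mulnDl mul1n leq_add2l.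
by move: xX; rewrite -(Xmax _ okx (subsetUr _ _)) setU11.
Qed.

(** * Collisions and quotients of differences *)

Lemma cauchy_schwarz_collisions (T U : finType) (f : T -> U) (B : {set T}) :
  (#|B| ^ 2 <= #|f @: B| *
     #|[set w in setX B B | f w.1 == f w.2]|)%N.
Proof.
pose m y := #|[set b in B | f b == y]|.
have sumB : #|B| = (\sum_(y in f @: B) m y)%N.
  rewrite -sum1_card (partition_big_imset f) /=; apply: eq_bigr => y _.
  by rewrite sum1dep_card.
have sumC : #|[set w in setX B B | f w.1 == f w.2]| = (\sum_(y in f @: B) m y ^ 2)%N.
  rewrite -sum1_card (partition_big (fun w => f w.1) (mem (f @: B))) /=; last first.
    by move=> w; rewrite !inE => /andP[/andP[w1 _] _]; apply: imset_f.
  apply: eq_bigr => y _; rewrite sum1dep_card -mulnn -cardsX.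
  apply: eq_card => -[u v]; rewrite !inE /=.
  case: (u \in B) => //=; case: (v \in B) => //=; last by rewrite andbF.
  by have [<-|] := eqVneq (f u) y; rewrite ?andbT ?andbF // eq_sym.
rewrite sumC sumB -leq_double -!mul2n.
rewrite expnS expn1 big_distrlr /=.
apply: (@leq_trans (\sum_(y in f @: B) \sum_(z in f @: B) (m y ^ 2 + m z ^ 2))).
  rewrite big_distrr leq_sum //= => y _; rewrite big_distrr leq_sum //= => z _.
  exact: nat_Cauchy.
under eq_bigr do rewrite big_split /= sum_nat_const.
by rewrite big_split /= sum_nat_const -big_distrr /= mul2n -addnn leqnn.
Qed.

(** Summed over all r, the number of collisions x + r y = x' + r y' is at most
    |X|^2 |F| + |X|^4, because a nontrivial pair of points is identified by at
    most one r.  An r with at most the average number of collisions has a large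
    image X + r X by Cauchy-Schwarz. *)
Lemma exists_large_dilate_sum (F : finFieldType) (X : {set F}) :
  exists r : F, (#|X| ^ 2 * #|F| <= #|X <+> dilate r X| * (#|F| + #|X| ^ 2))%N.
Proof.
have [->|X0] := eqVneq X set0; first by exists 0; rewrite cards0.
pose V := setX X X; pose f (r : F) (u : F * F) := u.1 + r * u.2.
pose coll r := #|[set w in setX V V | f r w.1 == f r w.2]|.
have sum_coll : (\sum_r coll r <= #|X| ^ 2 * #|F| + #|X| ^ 2 * #|X| ^ 2)%N.
  have cardV : #|V| = (#|X| ^ 2)%N by rewrite cardsX mulnn.
  have -> : (\sum_r coll r = \sum_(u in V) \sum_(v in V) \sum_r (f r u == f r v))%N.
    rewrite pair_big exchange_big /=; apply: eq_bigr => r _.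
    rewrite /coll -sum1_card [RHS]big_mkcond [LHS]big_mkcond /=.
    by apply: eq_bigr => -[u v] _; rewrite !inE /=; do 5!case: (_ \in _) => //=; case: eqP.
  apply: (@leq_trans (\sum_(u in V) \sum_(v in V) ((u == v) * #|F| + 1))%N).
    apply: leq_sum => u _; apply: leq_sum => v _; have [->|neq] := eqVneq u v.
      under eq_bigr do rewrite eqxx.
      by rewrite sum1_card mul1n addn1 leqnSn.
    rewrite mul0n add0n; apply: (@leq_trans #|[set r | f r u == f r v]|).
      rewrite -sum1_card [leqRHS]big_mkcond leq_sum // => r _.
      by rewrite inE; case: eqP.
    apply/card_le1_eqP => r s; rewrite !inE => /eqP er /eqP es.
    apply/eqP; apply: contraNT neq => neq.
    have eq2 : (r - s) * (u.2 - v.2) = 0.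
      have -> : (r - s) * (u.2 - v.2) = (f r u - f r v) - (f s u - f s v).
        by rewrite /f; ring.
      by rewrite er es !subrr.
    move/eqP: eq2; rewrite mulf_eq0 !subr_eq0 => /orP[|/eqP e2].
      by rewrite eq_sym (negPf neq).
    by move: er; rewrite /f e2 => /addIr; case: u v e2 {es} => ? ? [? ?] /= -> ->.
  under eq_bigr do rewrite big_split /= sum_nat_const muln1.
  rewrite big_split /= sum_nat_const cardV leq_add2r.
  rewrite -cardV -sum_nat_const leq_sum // => u uV.
  rewrite (bigD1 u) //= eqxx mul1n big1 ?addn0 // => v /andP[_ /negPf].
  by rewrite eq_sym => ->.
have [r rP] : exists r, (coll r * #|F| <= #|X| ^ 2 * #|F| + #|X| ^ 2 * #|X| ^ 2)%N.
  have [r _ rmin] := @arg_minnP _ (0 : F) xpredT coll isT.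
  exists r; apply: leq_trans sum_coll; rewrite mulnC -sum_nat_const leq_sum //.
exists r; have := cauchy_schwarz_collisions (f r) V.
have -> : f r @: V = X <+> dilate r X.
  apply/setP => z; apply/imsetP/sumsetP.
    by move=> [[x y] /setXP[/= xX yX] ->]; exists x, (r * y); rewrite imset_f.
  by move=> [x [_ [xX /imsetP[y yX ->] ->]]]; exists (x, y); rewrite ?inE ?xX.
rewrite -/(coll r) cardsX mulnn => CS.
rewrite -(leq_pmul2r (_ : 0 < #|X| ^ 2)%N) ?expn_gt0 ?card_gt0 ?X0 //.
rewrite mulnAC mulnn; apply: leq_trans (leq_mul CS (leqnn #|F|)) _.
rewrite -!mulnA leq_mul2l; apply/orP; right.
by apply: leq_trans rP _; rewrite mulnDl [(#|F| * _)%N]mulnC.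
Qed.

(** If r is not a quotient of differences of X then X + r X has the full size
    |X|^2.  Hence, if X + X + r X, which contains X + (r + 1) X, is small for a
    quotient r, then r + 1 is again a quotient.  Were it small for all of them,
    every element of the prime field would be a quotient, against
    [exists_large_dilate_sum]. *)
Lemma exists_large_ratio_sum (p : nat) (X : {set 'F_p}) : prime p -> (1 < #|X|)%N ->
  exists x1 x2 x3 x4 : 'F_p,
    [/\ x1 \in X, x2 \in X, x3 \in X & x4 \in X] /\ x3 != x4 /\
    (#|X| ^ 2 * p <= #|X <+> X <+> dilate ((x1 - x2) / (x3 - x4)) X|
                      * (p + #|X| ^ 2))%N.
Proof.
move=> p_pr X_gt1.
pose is_ratio (r : 'F_p) := [exists x1 in X, exists x2 in X, exists x3 in X, exists x4 in X,
  (x3 != x4) && (r == (x1 - x2) / (x3 - x4))].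
pose large (r : 'F_p) := (#|X| ^ 2 * p <= #|X <+> X <+> dilate r X| * (p + #|X| ^ 2))%N.
have [/existsP[r /andP[]]|/existsPn small] := boolP [exists r, is_ratio r && large r].
  move=> /exists_inP[x1 x1X] /exists_inP[x2 x2X] /exists_inP[x3 x3X].
  move=> /exists_inP[x4 x4X] /andP[neq /eqP->] lr.
  by exists x1, x2, x3, x4.
have [x0 [y0 [x0X y0X neq0]]] : exists x y, [/\ x \in X, y \in X & x != y].
  by case/card_gt1P: X_gt1 => x [y [? ? ?]]; exists x, y.
have inj (r : 'F_p) : ~~ is_ratio r -> (#|X| ^ 2 <= #|X <+> dilate r X|)%N.
  move=> nr; rewrite -mulnn -cardsX.
  rewrite -(@card_in_imset _ _ (fun u => u.1 + r * u.2)); last first.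
    move=> [u v] [u' v'] /setXP[/= uX vX] /setXP[/= u'X v'X] e.
    have [ev|nv] := eqVneq v v'; first by move: e; rewrite ev => /addIr ->.
    case/negP: nr; apply/exists_inP; exists u' => //; apply/exists_inP; exists u => //.
    apply/exists_inP; exists v => //; apply/exists_inP; exists v' => //.
    rewrite nv eq_sym -(inj_eq (mulIf (_ : v - v' != 0))) ?subr_eq0 // divfK ?subr_eq0 //=.
    by apply/eqP; rewrite mulrBr; apply/eqP; rewrite subr_eq addrAC eq_sym subr_eq addrC -e addrC.
  apply/subset_leq_card/subsetP => _ /imsetP[[u v] /setXP[/= uX vX] ->].
  by rewrite mem_sumset // imset_f.
have step (r : 'F_p) : is_ratio r -> is_ratio (r + 1).
  move=> rr; have := small r; rewrite rr /=; apply: contraR => /inj le1.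
  have le2 : (#|X <+> dilate (r + 1)%R X| <= #|X <+> X <+> dilate r X|)%N.
    apply/subset_leq_card/subsetP => _ /sumsetP[x [_ [xX /imsetP[y yX ->] ->]]].
    by rewrite mulrDl mul1r [r * y + y]addrC addrA !mem_sumset // imset_f.
  rewrite /large; have := leq_trans le1 le2; nia.
have all_ratio (r : 'F_p) : is_ratio r.
  rewrite -(natr_Zp r); elim: (r : nat) => [|k IHk]; last by rewrite -natr1 step.
  apply/exists_inP; exists x0 => //; apply/exists_inP; exists x0 => //.
  apply/exists_inP; exists x0 => //; apply/exists_inP; exists y0 => //.
  by rewrite neq0 subrr mul0r /=.
have [r] := exists_large_dilate_sum X; rewrite card_Fp // => lr.
have := small r; rewrite all_ratio /= => /negP[].
apply: leq_trans lr _; rewrite leq_mul2r; apply/orP; right.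
rewrite -sumsetA; exact: leq_sumset x0X.
Qed.

(** * Equal differences of squares *)

Lemma card_equal_squares (F : finFieldType) (A : {set F}) :
  (#|[set w in setX A A | w.1 ^+ 2 == w.2 ^+ 2]| <= 2 * #|A|)%N.
Proof.
pose g (u : bool * F) := (u.2, (-1) ^+ u.1 * u.2).
have <- : #|setX [set: bool] A| = (2 * #|A|)%N by rewrite cardsX cardsT card_bool.
apply: leq_trans (leq_imset_card g _).
apply/subset_leq_card/subsetP => -[a b]; rewrite !inE /= => /andP[/andP[aA _]].
rewrite eq_sym eqf_sqr => /orP[]/eqP->; apply/imsetP.
  by exists (false, a); rewrite ?inE //= /g /= mul1r.
by exists (true, a); rewrite ?inE //= /g /= mulN1r.
Qed.

(** The pairs (a, b) for which (a - b)(a + b) = d0 (a' + b') for some a', b' in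
    A with a' - b' = d0. *)
Definition matched_pairs (F : finFieldType) (A : {set F}) (d0 : F) : {set F * F} :=
  [set w in setX A A | [exists u in setX A A,
     (u.1 - u.2 == d0) && (w.1 ^+ 2 - w.2 ^+ 2 == u.1 ^+ 2 - u.2 ^+ 2)]].

(** The solutions of a^2 + b'^2 = a'^2 + b^2 in A number at least
    |A|^4 / |S + S|, S being the set of squares, by Cauchy-Schwarz.  Sort them
    by d = a' - b'.  Those with d = 0 also satisfy a^2 = b^2, so there are at
    most 2 |A|^2 of them; for d nonzero, (a, b) determines a'^2 - b'^2, hence
    a' + b', hence a' and b', so that they are counted by the matched pairs. *)
Lemma rich_difference (F : finFieldType) (A : {set F}) : 2 != 0 :> F ->
  exists d0 : F,
    (#|A| ^ 4 <= #|square_set A <+> square_set A| *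
       (2 * #|A| ^ 2 + #|A <+> oppset A| * #|matched_pairs A d0|))%N.
Proof.
move=> two_neq0.
have [d0 d0_neq0 d0max] := @arg_maxnP _ (1 : F) (fun d => d != 0)
  (fun d => #|matched_pairs A d|) (oner_neq0 F).
exists d0; pose f (u : F * F) := u.1 ^+ 2 + u.2 ^+ 2.
have imf : f @: setX A A = square_set A <+> square_set A.
  apply/setP => z; apply/imsetP/sumsetP.
    by move=> [[a b] /setXP[/= aA bA] ->]; exists (a ^+ 2), (b ^+ 2); split=> //; apply: imset_f.
  move=> [_ [_ [/imsetP[a aA ->] /imsetP[b bA ->] ->]]].
  by exists (a, b); rewrite ?inE ?aA.
have := cauchy_schwarz_collisions f (setX A A).
rewrite imf cardsX mulnn -expnM => /leq_trans; apply; rewrite leq_mul2l; apply/orP; right.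
(* A collision is ((a, b'), (a', b)): it is regrouped as a^2 - b^2 = a'^2 - b'^2. *)
set coll := [set w in _ | _].
pose diff (w : (F * F) * (F * F)) := w.2.1 - w.1.2.
have collP w : w \in coll ->
    [/\ w.1.1 \in A, w.1.2 \in A, w.2.1 \in A, w.2.2 \in A &
        w.1.1 ^+ 2 - w.2.2 ^+ 2 = w.2.1 ^+ 2 - w.1.2 ^+ 2].
  case: w => -[a b'] [a' b]; rewrite !inE /f /=.
  move=> /andP[/andP[/andP[-> ->] /andP[-> ->]] /eqP e]; split=> //.
  by apply/eqP; rewrite subr_eq addrAC eq_sym subr_eq e.
rewrite -sum1_card (partition_big diff (mem (A <+> oppset A))) /=; last first.
  by move=> w /collP[_ b'A a'A _ _]; rewrite mem_sumset ?mem_oppset.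
rewrite (bigID (pred1 0)) /= leq_add //.
  apply: (@leq_trans (\sum_(d | d == 0%R :> F) \sum_(w in coll | diff w == d) 1)%N).
    rewrite [leqLHS]big_mkcondl /= leq_sum // => d _.
    by case: ifP.
  rewrite big_pred1_eq sum1dep_card.
  pose g (u : F * (F * F)) := ((u.2.1, u.1), (u.1, u.2.2)).
  rewrite expnS expn1 mulnCA -[leqRHS]/(_ * _)%N.
  apply: leq_trans (leq_mul (leqnn #|A|) (card_equal_squares A)).
  rewrite -cardsX; apply: leq_trans (leq_imset_card g _).
  apply/subset_leq_card/subsetP => -[[a b'] [a' b]]; rewrite inE => /andP[].
  move=> /collP[/= aA b'A a'A bA e]; rewrite /diff /= subr_eq0 => /eqP a'b'.
  apply/imsetP; exists (b', (a, b)); last by rewrite /g /= a'b'.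
  by rewrite !inE /= b'A aA bA /= -subr_eq0 e a'b' subrr.
apply: (@leq_trans (\sum_(d in A <+> oppset A) #|matched_pairs A d0|)%N); last first.
  by rewrite sum_nat_const.
rewrite [leqLHS]big_mkcondr /= leq_sum // => d _; case: ifP => // d_neq0.
apply: leq_trans (d0max _ d_neq0); rewrite sum1dep_card.
rewrite -(@card_in_imset _ _ (fun w => (w.1.1, w.2.2))); last first.
  move=> [[a b'] [a' b]] [[c e'] [c' e]].
  move=> /setIdP[/collP[/= _ _ _ _ ew] /eqP dw] /setIdP[/collP[/= _ _ _ _ ew'] /eqP dw'].
  rewrite /diff /= in dw dw' *.
  move=> [eac ebe]; rewrite -{c}eac -{e}ebe in ew' *.
  have sum_eq : a' + b' = c' + e'.
    apply: (mulfI d_neq0); rewrite -{1}dw -dw' -!subr_sqr -ew -ew' //.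
  have eac : a' = c'.
    have double (u v : F) : 2 * u = (u + v) + (u - v) by ring.
    by apply: (mulfI two_neq0); rewrite (double a' b') (double c' e') sum_eq dw dw'.
  by move: sum_eq; rewrite eac => /addrI ->.
apply/subset_leq_card/subsetP => _ /imsetP[[[a b'] [a' b]] + ->] => /setIdP[].
move=> /collP[/= aA b'A a'A bA e] /eqP dw; rewrite !inE /= aA bA /=.
by apply/existsP; exists (a', b'); rewrite !inE a'A b'A e /= -dw !eqxx.
Qed.

(** The indices where f is below h / (2 |D|) contribute at most h / 2 to the
    sum. *)
Lemma popular (R : realFieldType) (I : finType) (D : {set I}) (f : I -> nat)
    (n : nat) (h : R) :
  (0 < #|D|)%N -> (forall i, i \in D -> (f i <= n)%N) ->
  h <= (\sum_(i in D) f i)%:R ->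
  h / 2 <= #|[set i in D | h / (2 * #|D|%:R) <= (f i)%:R]|%:R * n%:R.
Proof.
move=> D_gt0 f_le h_le; set X := [set i in D | _].
have D_gt0R : 0 < #|D|%:R :> R by rewrite ltr0n.
have [h_le0|h_gt0] := lerP h 0.
  by apply: (@le_trans _ _ 0); [lra | rewrite -natrM ler0n].
have: (\sum_(i in D) f i)%:R <= \sum_(i in D) ((i \in X)%:R * n%:R + h / (2 * #|D|%:R)) :> R.
  rewrite natr_sum ler_sum // => i iD; case: (boolP (i \in X)) => iX.
    rewrite mul1r (le_trans (_ : _ <= n%:R)) ?ler_nat ?f_le // lerDl.
    by rewrite divr_ge0 ?mulr_ge0 // ltW.
  by rewrite mul0r add0r ltW // real_ltNge ?num_real //; move: iX; rewrite inE iD.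
have cst : \sum_(i in D) h / (2 * #|D|%:R) = h / 2.
  by rewrite sumr_const -[LHS]mulr_natr; field; rewrite gt_eqF.
rewrite big_split /= cst -mulr_suml -natr_sum.
have -> : (\sum_(i in D) (i \in X) = #|X|)%N.
  rewrite -sum1_card big_mkcond [RHS]big_mkcond; apply: eq_bigr => i _.
  by rewrite [i \in X]inE; case: (i \in D); case: (_ <= _).
lra.
Qed.

(** A matched pair (a, b) is sorted by d = a - b and then recorded by a alone. *)
Definition matched_points (F : finFieldType) (A : {set F}) (d0 d : F) : {set F} :=
  [set a | (a, a - d) \in matched_pairs A d0].

Lemma sum_card_matched_points (F : finFieldType) (A : {set F}) d0 :
  (\sum_(d in A <+> oppset A) #|matched_points A d0 d|)%N = #|matched_pairs A d0|.
Proof.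
rewrite -[RHS]sum1_card.
rewrite (partition_big (fun w => w.1 - w.2) (mem (A <+> oppset A))) /=; last first.
  move=> [a b] /setIdP[/setXP[/= aA bA] _]; by rewrite mem_sumset ?mem_oppset.
apply: eq_bigr => d _; rewrite sum1dep_card.
rewrite -(@card_imset _ _ (fun a => (a, a - d))); last by move=> a b [].
apply: eq_card => -[a b]; apply/imsetP/setIdP => /=.
  by move=> [c + [-> ->]]; rewrite inE => ->; rewrite subKr eqxx.
move=> [w /eqP dE]; exists a; last by rewrite -dE subKr.
by rewrite inE -dE subKr.
Qed.

(** Set B = matched_points A d0 d.  For b in B, 2 d b equals d^2 + d0 (2 a - d0)
    for some a in A, so that d (2B - 2B) lies in 2 d0 (A - A).  Covering P by
    translates of 2B - 2B and dilating by d thus covers d P by translates of a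
    set that does not depend on d. *)
Lemma dilate_cover (F : finFieldType) (A P : {set F}) (d0 d : F) :
  2 != 0 :> F -> matched_points A d0 d != set0 ->
  exists2 X : {set F},
    (#|X| * #|matched_points A d0 d| <= #|P <+> dilate 2%R A|)%N &
    forall y, y \in P -> exists x a b,
      [/\ x \in X, a \in A, b \in A & d * y = x + (d0 * 2) * (a - b)].
Proof.
move=> two_neq0 B0; set B := matched_points A d0 d.
have sBA : B \subset A by apply/subsetP => a; rewrite !inE => /andP[/andP[]].
have cardB : #|dilate 2 B| = #|B| by rewrite card_imset //; apply: mulfI.
have B20 : dilate 2 B != set0 by rewrite -card_gt0 cardB card_gt0.
have [X leX sPX] := ruzsa_covering P B20.
have BP b : b \in B -> exists2 a, a \in A & d * (2 * b) = d ^+ 2 + d0 * (2 * a - d0).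
  rewrite inE => /setIdP[_ /existsP[[u v]]]; rewrite inE /=.
  move=> /andP[/andP[uA _] /andP[/eqP uv /eqP e]]; exists u => //.
  have -> : d0 * (2 * u - d0) = u ^+ 2 - v ^+ 2 by rewrite -uv; ring.
  by rewrite -e; ring.
exists (dilate d X).
  rewrite (leq_trans _ (subset_leq_card (sumsetS (subxx P) (imsetS _ sBA)))) //.
  by apply: leq_trans leX; rewrite -cardB leq_mul2r leq_imset_card orbT.
move=> y /(subsetP sPX)/sumsetP[x [_ [xX /sumsetP[u [v [uB vB ->]]] ->]]].
case/imsetP: uB => b bB ->; case/imsetP: vB => _ /imsetP[b' b'B ->] ->.
have [a aA ea] := BP _ bB; have [a' a'A ea'] := BP _ b'B.
exists (d * x), a, a'; split=> //; first exact: imset_f.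
by rewrite !mulrDr mulrN ea ea'; ring.
Qed.

(** Multiplying by x3 - x4 turns u + v + r w into
    x3 (u + v) - x4 (u + v) + x1 w - x2 w, and translating by (x1 - x2) z with
    a fixed z in X turns w into w + z, an element of X + X.  The same covering
    hypothesis for X + X then serves all four terms. *)
Lemma card_ratio_sumset (R : realFieldType) (F : finFieldType)
    (A X : {set F}) (m : R) (d0 x1 x2 x3 x4 : F) : X != set0 -> x3 != x4 ->
  (forall x, x \in [:: x1; x2; x3; x4] -> exists2 Y : {set F}, #|Y|%:R <= m &
    forall y, y \in X <+> X -> exists t a b,
      [/\ t \in Y, a \in A, b \in A & x * y = t + d0 * (a - b)]) ->
  #|X <+> X <+> dilate ((x1 - x2) / (x3 - x4)) X|%:R <=
     m ^+ 4 * #|nfold_sumset 4 A <+> oppset (nfold_sumset 4 A)|%:R.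
Proof.
move=> /set0Pn[z zX] neq cover; set Y := X <+> X <+> _.
have [|Y1 m1 c1] := cover x1; first by rewrite !inE eqxx.
have [|Y2 m2 c2] := cover x2; first by rewrite !inE eqxx orbT.
have [|Y3 m3 c3] := cover x3; first by rewrite !inE eqxx !orbT.
have [|Y4 m4 c4] := cover x4; first by rewrite !inE eqxx !orbT.
have delta_neq0 : x3 - x4 != 0 by rewrite subr_eq0.
set W := nfold_sumset 4 A <+> oppset (nfold_sumset 4 A).
rewrite -(card_imset _ (mulfI delta_neq0)) -(card_translate ((x1 - x2) * z)).
pose Z := Y3 <+> oppset Y4 <+> Y1 <+> oppset Y2 <+> dilate d0 W.
apply: (@le_trans _ _ #|Z|%:R).
  rewrite ler_nat; apply/subset_leq_card/subsetP => _ /sumsetP[_ [_ [/set1P-> /imsetP[y yY ->] ->]]].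
  have /sumsetP[uv [_ [uvP /imsetP[w wX ->] ->]]] := yY.
  have wzP : w + z \in X <+> X by rewrite mem_sumset.
  have [t1 [a1 [b1 [t1Y a1A b1A e1]]]] := c1 _ wzP.
  have [t2 [a2 [b2 [t2Y a2A b2A e2]]]] := c2 _ wzP.
  have [t3 [a3 [b3 [t3Y a3A b3A e3]]]] := c3 _ uvP.
  have [t4 [a4 [b4 [t4Y a4A b4A e4]]]] := c4 _ uvP.
  have -> : (x1 - x2) * z + (x3 - x4) * (uv + (x1 - x2) / (x3 - x4) * w) =
      t3 + - t4 + t1 + - t2 + d0 * ((a3 + (b4 + (a1 + (b2 + 0)))) -
                                    (b3 + (a4 + (b1 + (a2 + 0))))).
    transitivity (x3 * uv - x4 * uv + x1 * (w + z) - x2 * (w + z)).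
      by field.
    by rewrite e1 e2 e3 e4; ring.
  rewrite /Z !mem_sumset ?mem_oppset ?imset_f // mem_sumset ?mem_oppset //;
  by rewrite !mem_nfold_sumsetS ?mem_nfold_sumset0.
have leM (U V : {set F}) (u v : R) : #|U|%:R <= u -> #|V|%:R <= v ->
    #|U <+> V|%:R <= u * v.
  move=> leU leV; apply: le_trans (ler_pM _ _ leU leV); rewrite ?ler0n //.
  by rewrite -natrM ler_nat leq_card_sumset.
apply: (leM); last by rewrite ler_nat leq_imset_card.
rewrite 3!exprSr expr1; do 3!(apply: (leM); last by rewrite ?card_oppset).
by [].
Qed.

(** * The bound *)

Lemma card_square_set (F : finFieldType) (A : {set F}) :
  (#|A| <= 2 * #|square_set A|)%N.
Proof.
have [->|A0] := eqVneq A set0; first by rewrite cards0.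
rewrite -(leq_pmul2r (_ : 0 < #|A|)%N) ?card_gt0 // mulnn.
apply: leq_trans (cauchy_schwarz_collisions (fun a => a ^+ 2) A) _.
by rewrite mulnAC mulnC leq_mul // card_equal_squares.
Qed.

(** The exponents: the set X of popular differences has size at least
    L = n / (4 K^2 M), and each d in X has at least N = n / (4 K^4 M) matched
    points.  As X + X plus the dilate of A by 2
    has at most K^6 n elements, covering costs kappa = K^6 n / N =
    4 K^10 M translates for each of the four coefficients.  Altogether
    L^2 <= (1 + e) kappa^4 K^8 n. *)
Lemma square_sumset_bound (R : realFieldType) (p : nat) (A : {set 'F_p})
    (K M e : R) :
  prime p -> A != set0 -> 0 <= e ->
  #|A|%:R ^+ 2 <= e * p%:R ->
  #|A <+> A|%:R <= K * #|A|%:R ->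
  #|square_set A <+> square_set A|%:R <= M * #|A|%:R ->
  #|A|%:R <= 2 ^+ 12 * (1 + e) * M ^+ 6 * K ^+ 52.
Proof.
move=> p_pr A0 e_ge0 A_small AK SM; set n : R := #|A|%:R.
have n_ge1 : 1 <= n by rewrite ler1n card_gt0.
have n_gt0 : 0 < n by apply: lt_le_trans n_ge1.
have p_gt0 : 0 < p%:R :> R by rewrite ltr0n prime_gt0.
have K_ge1 : 1 <= K.
  rewrite -(ler_pM2r n_gt0) mul1r; apply: le_trans AK; rewrite ler_nat.
  by have [a aA] := set0Pn _ A0; apply: leq_sumset aA.
have M_ge : 2^-1 <= M.
  rewrite -(ler_pM2r n_gt0); apply: le_trans SM.
  rewrite mulrC ler_pdivrMr // -natrM ler_nat mulnC.
  apply: leq_trans (card_square_set A) _; rewrite leq_mul2l /=.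
  have [a aA] := set0Pn _ A0; apply: leq_sumset (_ : a ^+ 2 \in _); exact: imset_f.
have K_gt0 : 0 < K by lra.
have M_gt0 : 0 < M by lra.
have Kpow i : 1 <= K ^+ i by rewrite exprn_ege1.
(* In this range X could have fewer than two elements, or the quadruples
   with a' = b' could dominate. *)
have trivial_range : n <= 4 * K ^+ 2 * M -> n <= 2 ^+ 12 * (1 + e) * M ^+ 6 * K ^+ 52.
  move=> /le_trans; apply.
  have -> : 2 ^+ 12 * (1 + e) * M ^+ 6 * K ^+ 52 =
            4 * K ^+ 2 * M * ((1 + e) * ((2 ^+ 5 * M ^+ 5) * (2 ^+ 5 * K ^+ 50))) by ring.
  apply: ler_peMr; first by rewrite ltW // !mulr_gt0 ?exprn_gt0.
  rewrite mulr_ege1 //; first by lra.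
  rewrite mulr_ege1 //; first by rewrite -exprMn exprn_ege1 //; lra.
  by have := Kpow 50; lra.
have [p2|p_neq2] := eqVneq p 2.
  apply: trivial_range; apply: (@le_trans _ _ 2).
    have := max_card (mem A); rewrite card_Fp // => leA.
    by rewrite (ler_nat R _ 2); apply: leq_trans leA _; rewrite p2.
  have := ler_pM _ _ (Kpow 2) M_ge; rewrite mul1r; lra.
have two_neq0 : 2 != 0 :> 'F_p.
  rewrite -(dvdn_pcharf (pchar_Fp p_pr)); apply: contraNN p_neq2.
  by rewrite dvdn_prime2.
have [//|n_big] := lerP n (4 * K ^+ 2 * M).
have [d0 rich] := rich_difference A two_neq0.
set D := A <+> oppset A in rich.
have DK : #|D|%:R <= K ^+ 2 * n.
  by have := card_nfold_difference 1 1 A0 AK; rewrite !nfold_sumset1.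
have D_gt0 : (0 < #|D|)%N.
  have [a aA] := set0Pn _ A0.
  by apply/card_gt0P; exists (a - a); rewrite mem_sumset ?mem_oppset.
(* The quadruples with a' <> b' number at least n^3 / (2 M), spread over at most
   K^2 n values of a' - b'. *)
pose h : R := n ^+ 2 / (2 * K ^+ 2 * M).
have h_gt0 : 0 < h by rewrite divr_gt0 ?mulr_gt0 ?exprn_gt0.
have h_le : h <= #|matched_pairs A d0|%:R.
  move: rich; rewrite -(ler_nat R) natrM natrD [(2 * _)%:R]natrM !natrX !natrM -/n => rich.
  set H := #|matched_pairs A d0|%:R in rich *.
  have H_ge0 : 0 <= H by rewrite ler0n.
  have rich' : n ^+ 4 <= (M * n) * (2 * n ^+ 2 + K ^+ 2 * n * H).
    apply: le_trans rich _; apply: ler_pM => //.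
      by rewrite addr_ge0 ?mulr_ge0 ?exprn_ge0 ?ler0n.
    by rewrite lerD2l ler_wpM2r.
  have {}rich' : n ^+ 2 <= M * (2 * n + K ^+ 2 * H).
    rewrite -(ler_pM2r (exprn_gt0 2 n_gt0)).
    by apply: le_trans (le_trans rich' _); rewrite le_eqVlt; apply/orP; left; apply/eqP; ring.
  have small : 2 * (M * (2 * n)) <= n ^+ 2.
    have : 4 * M <= n.
      apply: le_trans (ltW n_big); rewrite ler_pM2r // ler_peMr //.
    rewrite -(ler_pM2r n_gt0); lra.
  rewrite ler_pdivrMr ?mulr_gt0 ?exprn_gt0 //; lra.
have pop := @popular R _ D (fun d => #|matched_points A d0 d|) #|A| h D_gt0.
rewrite sum_card_matched_points in pop.
set X := [set _ in D | _] in pop.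
have {}pop : h / 2 <= #|X|%:R * n.
  apply: pop h_le => d _; apply/subset_leq_card/subsetP => a.
  by rewrite inE => /setIdP[/setXP[]].
pose L := n / (4 * K ^+ 2 * M).
have L_gt0 : 0 < L by rewrite divr_gt0 ?mulr_gt0 ?exprn_gt0.
have XL : L <= #|X|%:R.
  rewrite -(ler_pM2r n_gt0); apply: le_trans pop.
  rewrite le_eqVlt; apply/orP; left; apply/eqP; rewrite /L /h; field.
  by rewrite !gt_eqF.
have X_gt1 : (1 < #|X|)%N.
  rewrite -(ltr_nat R); apply: lt_le_trans XL.
  by rewrite ltr_pdivlMr ?mulr_gt0 ?exprn_gt0 // mul1r.
pose N := n / (4 * K ^+ 4 * M).
have N_gt0 : 0 < N by rewrite divr_gt0 ?mulr_gt0 ?exprn_gt0.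
have fibreN d : d \in X -> N <= #|matched_points A d0 d|%:R.
  rewrite inE => /andP[_]; apply: le_trans.
  rewrite ler_pdivlMr ?mulr_gt0 ?ltr0n //.
  apply: (@le_trans _ _ (N * (2 * (K ^+ 2 * n)))); first by rewrite !ler_pM2l.
  rewrite le_eqVlt; apply/orP; left; apply/eqP; rewrite /N /h; field.
  by rewrite !gt_eqF.
have PK : #|X <+> X <+> dilate 2 A|%:R <= K ^+ 6 * n.
  apply: le_trans (card_nfold_difference 4 2 A0 AK); rewrite ler_nat.
  apply/subset_leq_card/subsetP => _ /sumsetP[_ [_ [/sumsetP[x [y [xX yX ->]]] /imsetP[a aA ->] ->]]].
  move: xX yX; rewrite !inE => /andP[/sumsetP[a1 [_ [a1A /imsetP[b1 b1A ->] ->]]] _].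
  move=> /andP[/sumsetP[a2 [_ [a2A /imsetP[b2 b2A ->] ->]]] _].
  have -> : a1 - b1 + (a2 - b2) + 2 * a =
     (a1 + (a2 + (a + (a + 0)))) - (b1 + (b2 + 0)) by ring.
  by rewrite mem_sumset ?mem_oppset // !mem_nfold_sumsetS ?mem_nfold_sumset0.
pose kappa := 4 * K ^+ 10 * M.
have cover d : d \in X -> exists2 Y : {set 'F_p}, #|Y|%:R <= kappa &
    forall y, y \in X <+> X -> exists t a b,
      [/\ t \in Y, a \in A, b \in A & d * y = t + (d0 * 2) * (a - b)].
  move=> dX; have fibre_gt0 := lt_le_trans N_gt0 (fibreN d dX).
  have fibre_neq0 : matched_points A d0 d != set0 by rewrite -card_gt0 -(ltr_nat R).
  have [Y leY Ycover] := dilate_cover (X <+> X) two_neq0 fibre_neq0.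
  exists Y => //; rewrite -(ler_pM2r N_gt0).
  apply: (@le_trans _ _ (K ^+ 6 * n)).
    apply: le_trans PK; apply: (@le_trans _ _ (#|Y| * #|matched_points A d0 d|)%:R).
      by rewrite natrM ler_wpM2l ?fibreN.
    by rewrite ler_nat.
  rewrite le_eqVlt; apply/orP; left; apply/eqP; rewrite /N /kappa; field.
  by rewrite !gt_eqF.
have [x1 [x2 [x3 [x4 [[x1X x2X x3X x4X] [neq large]]]]]] := exists_large_ratio_sum p_pr X_gt1.
have X0 : X != set0 by rewrite -card_gt0 ltnW.
set Y := X <+> X <+> _ in large.
have Y_le : #|Y|%:R <= kappa ^+ 4 * (K ^+ 8 * n).
  apply: le_trans (@card_ratio_sumset R _ A X kappa (d0 * 2) _ _ _ _ X0 neq _) _.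
    by move=> x; rewrite !inE => /or4P[]/eqP->; apply: cover.
  apply: ler_wpM2l (card_nfold_difference 4 4 A0 AK).
  by rewrite exprn_ge0 // ltW // !mulr_gt0 ?exprn_gt0.
move: large; rewrite -(ler_nat R) !natrM natrD !natrX => large.
have x_gt0 : 0 < #|X|%:R :> R by rewrite ltr0n ltnW.
set x : R := #|X|%:R in XL large x_gt0; set y : R := #|Y|%:R in Y_le large.
have y_ge0 : 0 <= y by rewrite ler0n.
have L2p : L ^+ 2 <= e * p%:R.
  apply: le_trans A_small; apply: lerXn2r; rewrite ?nnegrE ?(ltW L_gt0) ?(ltW n_gt0) //.
  rewrite ler_pdivrMr ?mulr_gt0 ?exprn_gt0 //; apply: ler_peMr; first exact: ltW.
  have := ler_pM _ _ (Kpow 2) M_ge; rewrite mul1r; lra.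
have L2x : L ^+ 2 <= x ^+ 2 by apply: lerXn2r; rewrite ?nnegrE ?(ltW L_gt0) ?(ltW x_gt0).
(* x^2 p / (p + x^2) increases with x, so x may be replaced by L, and
   L^2 <= e p. *)
have L2y : L ^+ 2 <= (1 + e) * y.
  rewrite -(ler_pM2r p_gt0) -(ler_pM2r (exprn_gt0 2 x_gt0)).
  apply: (@le_trans _ _ (y * (p%:R + x ^+ 2) * L ^+ 2)).
    rewrite (_ : L ^+ 2 * _ * _ = x ^+ 2 * p%:R * L ^+ 2); last by ring.
    by rewrite ler_wpM2r ?sqr_ge0.
  rewrite (_ : _ * L ^+ 2 = y * (p%:R * L ^+ 2 + x ^+ 2 * L ^+ 2)); last by ring.
  rewrite (_ : _ * x ^+ 2 = y * (p%:R * x ^+ 2 + x ^+ 2 * (e * p%:R))); last by ring.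
  by rewrite ler_wpM2l // lerD // ler_wpM2l ?sqr_ge0 // ltW.
have : L ^+ 2 <= (1 + e) * (kappa ^+ 4 * (K ^+ 8 * n)).
  by apply: le_trans L2y _; rewrite ler_wpM2l //; lra.
have s_gt0 : 0 < (4 * K ^+ 2 * M) ^+ 2 / n.
  by rewrite divr_gt0 ?exprn_gt0 ?mulr_gt0 ?exprn_gt0.
rewrite -(ler_pM2r s_gt0).
have -> : L ^+ 2 * ((4 * K ^+ 2 * M) ^+ 2 / n) = n.
  by rewrite /L; field; rewrite !gt_eqF.
have -> : (1 + e) * (kappa ^+ 4 * (K ^+ 8 * n)) * ((4 * K ^+ 2 * M) ^+ 2 / n) =
    2 ^+ 12 * (1 + e) * M ^+ 6 * K ^+ 52.
  by rewrite /kappa; field; rewrite !gt_eqF.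
by [].
Qed.

Theorem corollary1p6 (R : realType) (c : R) (hc : 0 < c) :
  exists2 C : R, 0 < C &
    forall (p : nat) (K : R) (A : {set 'F_p}),
      prime p ->
      0 < K ->
      #|A|%:R <= c * Num.sqrt (p%:R : R) ->
      #|nfold_sumset 2 A|%:R <= K * #|A|%:R ->
      C * (#|A|%:R `^ (1 + 9^-1)) * K ^- 6 <=
        #|nfold_sumset 3 (square_set A)|%:R.
Proof.
pose e : R := c ^+ 2; pose C0 : R := 2 ^+ 12 * (1 + e).
have e_ge0 : 0 <= e by rewrite sqr_ge0.
have e1_gt0 : 0 < 1 + e by lra.
have C0_gt0 : 0 < C0 by rewrite mulr_gt0 ?exprn_gt0.
pose C := (8 * C0) `^ (- 9^-1).
have C_gt0 : 0 < C by rewrite powR_gt0 // mulr_gt0.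
exists C => // p K A p_pr K_gt0 A_small AK.
have [->|A0] := eqVneq A set0.
  have exp_neq0 : 1 + 9^-1 != 0 :> R by apply: lt0r_neq0; lra.
  by rewrite cards0 powR0 // mulr0 mul0r ler0n.
set S := square_set A; set n : R := #|A|%:R; set t : R := #|_|%:R.
have [a aA] := set0Pn _ A0.
have aS : a ^+ 2 \in S by apply: imset_f.
have n_gt0 : 0 < n by rewrite ltr0n card_gt0.
have {}AK : #|A <+> A|%:R <= K * n.
  by move: AK; rewrite nfold_sumsetS nfold_sumset1.
have K_ge1 : 1 <= K.
  rewrite -(ler_pM2r n_gt0) mul1r; apply: le_trans AK; rewrite ler_nat.
  exact: leq_sumset aA.
have SSt : #|S <+> S|%:R <= t.
  by rewrite ler_nat !nfold_sumsetS nfold_sumset0 [S <+> [set 0]]sumsetC zero_sumset (leq_sumset _ aS).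
have nt : n <= 2 * t.
  apply: le_trans (_ : 2 * #|S|%:R <= _).
    by rewrite -natrM ler_nat card_square_set.
  rewrite ler_pM2l //; apply: le_trans SSt; rewrite ler_nat.
  exact: leq_sumset aS.
have n_small : n ^+ 2 <= e * p%:R.
  rewrite -(sqr_sqrtr (ler0n R p)) -exprMn; apply: lerXn2r; rewrite ?nnegrE //.
  by rewrite mulr_ge0 ?sqrtr_ge0 // ltW.
have main : n <= C0 * (t / n) ^+ 6 * K ^+ 52.
  apply: (square_sumset_bound p_pr A0 e_ge0 n_small AK).
  by rewrite divfK ?gt_eqF.
have {}main : n ^+ 7 <= C0 * t ^+ 6 * K ^+ 52.
  rewrite exprS; move: main; rewrite -(ler_pM2r (exprn_gt0 6 n_gt0)).
  by congr (_ <= _); field; rewrite gt_eqF.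
have t_gt0 : 0 < t by lra.
have power_bound : n ^+ 10 <= 8 * C0 * t ^+ 9 * K ^+ 54.
  have n3 : n ^+ 3 <= 8 * t ^+ 3.
    have -> : 8 * t ^+ 3 = (2 * t) ^+ 3 by ring.
    by apply: lerXn2r; rewrite ?nnegrE ?(ltW n_gt0) // ltW ?mulr_gt0.
  have -> : n ^+ 10 = n ^+ 7 * n ^+ 3 by ring.
  have -> : 8 * C0 * t ^+ 9 * K ^+ 54 =
    (C0 * t ^+ 6 * K ^+ 52) * (8 * t ^+ 3) * K ^+ 2 by ring.
  have prod_le : n ^+ 7 * n ^+ 3 <= (C0 * t ^+ 6 * K ^+ 52) * (8 * t ^+ 3).
    by apply: ler_pM; rewrite ?exprn_ge0 ?(ltW n_gt0).
  apply: le_trans prod_le _; apply: ler_peMr; last exact: exprn_ege1.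
  by rewrite ltW // !mulr_gt0 ?exprn_gt0.
have lhs_ge0 : 0 <= C * n `^ (1 + 9^-1) * K ^- 6.
  by rewrite !mulr_ge0 ?powR_ge0 ?invr_ge0 ?exprn_ge0 ?ltW.
have powR9 (u v : R) : (u `^ v) ^+ 9 = u `^ (v * 9%:R).
  by rewrite powRrM powR_mulrn ?powR_ge0.
rewrite -(@ler_pXn2r _ 9) ?nnegrE ?(ltW t_gt0) //.
rewrite !exprMn /C !powR9.
have -> : - 9^-1 * 9%:R = - 1 :> R by field.
have -> : (1 + 9^-1) * 9%:R = 10%:R :> R by field.
rewrite powR_inv1 ?powR_mulrn ?(ltW n_gt0) ?mulr_ge0 ?(ltW e1_gt0) //.
rewrite -exprVn -exprM -mulrA exprVn ler_pdivrMl ?mulr_gt0 //.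
by rewrite ler_pdivrMr ?exprn_gt0.
Qed.
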